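(* Suppose $\Lambda(X)=1$ and $\Lambda=\sum_{i\in\mathcal I}\lambda_i\Lambda_i$ on $\mathcal B$, where $\mathcal I$ is an at most countable set, $(\Lambda_i)_{i\in\mathcal I}$ is a family of distinct ergodic probability measures on $\mathcal B$, and $(\lambda_i)_{i\in\mathcal I}\subset(0,1]$. For each $i\in\mathcal I$ let $Z_i$ be a measurable version of the Radon-Nikodym derivative $d\Lambda_i/d\phi_0$ (on $\mathcal A_0$) and let $M_i\in(0,\infty]$ be the $\Lambda_i$-essential supremum of $Z_i$. Let $Q\in\mathcal B$. Then (i) $$\Phi(Q)\ge\sum_{i\in\mathcal I}\frac1{M_i}\Lambda_i(Q)+\overline{\Phi_0}^{\phi_0}_{\{Z=0\}}(Q),\quad\text{and}$$ (ii) $$\mathcal H_\alpha(\Lambda,\phi_0)(Q)=\sum_{i\in\mathcal I}\lambda_i^\alpha\Big(\frac1{M_i}\Big)^{1-\alpha}\Lambda_i(Q)\quad\text{for all }0<\alpha\le1.$$ The equality in (ii) is also true for $\alpha=0$ if $\phi_0\ll\Lambda$.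
   Context: Setting. Let $X$ be a set, $S:X\to X$ a bijection, $\mathcal A$ a $\sigma$-algebra on $X$, $\mathcal A_0$ the $\sigma$-algebra generated by $\bigcup_{i\ge 0}S^{-i}\mathcal A$, $\mathcal B$ the $\sigma$-algebra generated by $\bigcup_{i\in\mathbb Z}S^{-i}\mathcal A$, and $\mathcal A_m:=S^{-m}\mathcal A_0=\{S^{-m}A:A\in\mathcal A_0\}$ for integers $m\le 0$ (so $\mathcal A_0\subset\mathcal A_{-1}\subset\cdots$). Let $\phi_0$ be a finite positive measure on $\mathcal A_0$, and $\Lambda$ a finite positive measure on $\mathcal A_0$ with $\Lambda\circ S^{-1}=\Lambda$ and $\Lambda\ll\phi_0$; let $Z\ge0$ be an $\mathcal A_0$-measurable version of $d\Lambda/d\phi_0$. For $Q\subset X$ let $\mathcal C(Q)$ be the set of all sequences $(A_m)_{m\le0}$ with $A_m\in\mathcal A_m$ for all $m\le 0$ and $Q\subset\bigcup_{m\le0}A_m$. Define $\Phi(Q):=\inf_{(A_m)\in\mathcal C(Q)}\sum_{m\le0}\phi_0(S^mA_m)$. The symbol $\Lambda$ also denotes the unique $S$-invariant measure on $\mathcal B$ extending $\Lambda$. ''Ergodic'' means $S$-invariant and ergodic with respect to $S$. Conventions: $0\log0:=0$, $y^x:=e^{x\log y}$ and thus $0^0:=1$, $1/\infty:=0$. For $\alpha\ge0$ and $Q\subset X$: $\mathcal H_\alpha(\Lambda,\phi_0)(Q):=\inf_{(A_m)\in\mathcal C(Q)}\sum_{m\le0}\int_{S^mA_m}Z^\alpha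 d\phi_0$. For $\epsilon>0$: $\mathcal C^0_\epsilon(Q):=\{(A_m)\in\mathcal C(Q):\sum_{m\le0}\phi_0(S^mA_m)<\Phi(Q)+\epsilon\}$, and $\overline{\Phi_0}^{\phi_0}_{\{Z=0\}}(Q):=\lim_{\epsilon\to0}\sup_{(A_m)\in\mathcal C^0_\epsilon(Q)}\sum_{m\le0}\phi_0(\{Z=0\}\cap S^mA_m)$. *)

(* Defs.v *)
From HB Require Import structures.
From mathcomp Require Import all_boot all_order all_algebra.
From mathcomp Require Import all_classical all_reals all_analysis.
From mathcomp Require Import measurable_realfun ess_sup_inf.

Set Implicit Arguments.
Unset Strict Implicit.
Unset Printing Implicit Defensive.

Import Order.TTheory GRing.Theory Num.Theory.
Import numFieldNormedType.Exports.

Local Open Scope classical_set_scope.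
Local Open Scope ring_scope.
Local Open Scope ereal_scope.

(* Throughout, [S : X -> X] is meant to be a bijection. For [n : nat], the set
   S^(-n) E is the preimage [iter n S @^-1` E] and S^n E is the direct image
   [iter n S @` E]. Indices m <= 0 are encoded by [n : nat] with m = - n. *)

Definition gen0 (X : Type) (S : X -> X) (A : set (set X)) : set (set X) :=
  \bigcup_(i in [set: nat]) [set iter i S @^-1` E | E in A].

Definition genB (X : Type) (S : X -> X) (A : set (set X)) : set (set X) :=
  gen0 S A `|` \bigcup_(i in [set: nat]) [set iter i S @` E | E in A].

(* X equipped with the sigma-algebras A_0 and B. *)
Notation sigma0 S A := (g_sigma_algebraType (gen0 S A)).
Notation sigmaB S A := (g_sigma_algebraType (genB S A)).

(* The sigma-algebra A_m for m = - n. *)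
Definition sigma_neg (X : Type) (S : X -> X) (A : set (set X)) (n : nat) :
    set (set X) :=
  [set iter n S @` E | E in <<s gen0 S A >>].

Definition covers (X : Type) (S : X -> X) (A : set (set X)) (Q : set X) :
    set (nat -> set X) :=
  [set E | (forall n, sigma_neg S A n (E n)) /\ Q `<=` \bigcup_n E n].

(* The sum over m <= 0 of mu (S^m E_m). *)
Definition cover_sum (X : Type) (R : realType) (S : X -> X)
    (mu : set X -> \bar R) (E : nat -> set X) : \bar R :=
  \sum_(0 <= n <oo) mu (iter n S @^-1` E n).

Section outer_measures.
Context (X : pointedType) (R : realType) (S : X -> X) (A : set (set X)).
Variable phi0 : {measure set (sigma0 S A) -> \bar R}.
Variable Z : sigma0 S A -> \bar R.

Definition Phi (Q : set X) : \bar R :=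
  ereal_inf [set cover_sum S phi0 E | E in covers S A Q].

(* [poweR] satisfies 0 `^ 0 = 1. *)
Definition Halpha (alpha : R) (Q : set X) : \bar R :=
  ereal_inf [set cover_sum S
                   (fun B => \int[phi0]_(x in (B : set (sigma0 S A)))
                               poweR (Z x) alpha) E
            | E in covers S A Q].

Definition covers_eps (eps : R) (Q : set X) : set (nat -> set X) :=
  [set E | covers S A Q E /\ cover_sum S phi0 E < Phi Q + eps%:E].

Definition Phi0_bar (Q : set X) : \bar R :=
  lim ((ereal_sup [set cover_sum S
                        (fun B => phi0 ([set x | Z x = 0] `&` B)) E
                  | E in covers_eps eps Q]) @[eps --> (0%R : R)^'+]).

End outer_measures.

Definition measure_invariant (d : measure_display) (T : measurableType d)
    (R : realType) (S : T -> T) (mu : {measure set T -> \bar R}) : Prop :=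
  forall E : set T, measurable E -> mu (S @^-1` E) = mu E.

Definition measure_ergodic (d : measure_display) (T : measurableType d)
    (R : realType) (S : T -> T) (mu : {measure set T -> \bar R}) : Prop :=
  measure_invariant S mu /\
  forall E : set T, measurable E -> S @^-1` E = E ->
    mu E = 0 \/ mu (~` E) = 0.

(* f is a version of d nu / d mu. The set function nu may be defined on a
   larger sigma-algebra than mu; only its values on the measurable sets of T
   are used. *)
Definition is_RN_derivative (d : measure_display) (T : measurableType d)
    (R : realType) (mu : {measure set T -> \bar R}) (nu : set T -> \bar R)
    (f : T -> \bar R) : Prop :=
  measurable_fun [set: T] f /\
  forall E : set T, measurable E -> nu E = \int[mu]_(x in E) f x.

(* Main.v *)
(* A cover of Q by sets E_n = S^n B_n with B_n in A_0 costs sum nu(B_n), and its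
   infimum is an outer measure in Q. For nu the restriction of a finite
   S-invariant measure mu on B it coincides with mu on B, because the sets of
   the increasing algebras A_(-n) are Caratheodory measurable for it. Let mu be
   moreover ergodic, D in A_0 with mu(D) > 0, and nu <= K mu on the subsets of D
   in A_0: since almost every point lies in S^k D for arbitrarily large k, covers
   can be refined to covers by sets S^k B with B inside D, so the cost with
   respect to nu of Q is at most K mu(Q), up to a mu-null set.

   Applied to D = {Z_j <= Z_i}, this shows that two distinct components have
   Z_j > Z_i almost everywhere for Lambda_j, so that the Lambda_i live on disjoint
   sets G_i of A_0, on which Z = lambda_i Z_i. Applied to D = {Z_i > c} within
   G_i with c < M_i and nu = Z^alpha phi_0, it gives the upper bound in (ii) for
   the part of Q in G_i; the remaining part of Q is Lambda-null, and a
   Lambda-null set can be covered at arbitrarily small cost because nu is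
   absolutely continuous with respect to Lambda. The lower bounds follow by
   integrating over each G_i the inequality Z <= lambda_i M_i, raised to a
   power. *)
Require Import Defs.
From HB Require Import structures.
From mathcomp Require Import all_boot all_order all_algebra.
From mathcomp Require Import all_classical all_reals all_analysis.
From mathcomp Require Import measurable_realfun ess_sup_inf.
Import Order.TTheory GRing.Theory Num.Theory.
Import numFieldNormedType.Exports.
Local Open Scope classical_set_scope.
Local Open Scope ring_scope.
Local Open Scope ereal_scope.

(** * The filtration of the sigma-algebras A_m *)

Section filtration.
#[local] Set Implicit Arguments.
#[local] Unset Strict Implicit.
Context (X : pointedType) (S : X -> X) (A : set (set X)).
Hypothesis S_bij : bijective S.
Local Notation X0 := (sigma0 S A).
Local Notation XB := (sigmaB S A).

Let iter_inj n : injective (iter n S).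
Proof. by elim: n => // n IH x y /= /(bij_inj S_bij) /IH. Qed.

Let iter_surj n y : exists x, iter n S x = y.
Proof.
have [T _ TK] := S_bij; exists (iter n T y).
by elim: n => // n IH; rewrite iterSr [iter n.+1 T y]/= TK.
Qed.

Lemma image_iterK n (E : set X) : iter n S @^-1` (iter n S @` E) = E.
Proof.
apply/seteqP; split => x /=; last by exists x.
by move=> [y Ey /iter_inj <-].
Qed.

Lemma preimage_iterK n (E : set X) : iter n S @` (iter n S @^-1` E) = E.
Proof.
apply: image_preimage; apply/seteqP; split => // y _.
by have [x <-] := iter_surj n y; exists x.
Qed.

(** Turns membership in [A_(-n)] into measurability in [A_0], from which the closure properties
    below are inherited. *)
Lemma sigma_negP n E :
  sigma_neg S A n E <-> measurable (iter n S @^-1` E : set X0).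
Proof.
split=> [[F mF <-]|mE]; first by rewrite image_iterK.
by exists (iter n S @^-1` E) => //; exact: preimage_iterK.
Qed.

Lemma measurable_shift0 : measurable_fun [set: X0] (S : X0 -> X0).
Proof.
apply: (@measurability _ _ X0 X0 _ _ (gen0 S A)) => // _ [_ [i _ [E AE <-]] <-].
rewrite setTI; apply: sub_sigma_algebra; exists i.+1 => //.
by exists E => //; apply/seteqP; split => x; rewrite /= -iterSr.
Qed.

Lemma measurable_shiftB : measurable_fun [set: XB] (S : XB -> XB).
Proof.
apply: (@measurability _ _ XB XB _ _ (genB S A)) => // _ [_ [[i _ [E AE <-]]|[i _ [E AE <-]]] <-].
  rewrite setTI; apply: sub_sigma_algebra; left; exists i.+1 => //.
  by exists E => //; apply/seteqP; split => x; rewrite /= -iterSr.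
rewrite setTI; apply: sub_sigma_algebra; case: i => [|i].
  left; exists 1%N => //; exists E => //.
  by apply/seteqP; split => x /=; [exists (S x)|case=> y Ey <-].
right; exists i => //; exists E => //; apply/seteqP; split => x /=.
  by case=> y Ey <-; exists y.
by case=> y Ey /(bij_inj S_bij) <-; exists y.
Qed.

(** The image under [S] is the preimage under its inverse [T], and preimages under [T] of generators
    of [B] are again generators. *)
Lemma measurable_image_iterB n (E : set XB) :
  measurable E -> measurable (iter n S @` E : set XB).
Proof.
have [T ST TS] := S_bij.
have mT : measurable_fun [set: XB] (T : XB -> XB).
  apply: (@measurability _ _ XB XB _ _ (genB S A)) => // _ [_ [[i _ [F AF <-]]|[i _ [F AF <-]]] <-];
    rewrite setTI; apply: sub_sigma_algebra; last first.
    right; exists i.+1 => //; exists F => //.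
    apply/seteqP; split => x /=; first by case=> y Fy <-; exists y.
    by case=> y Fy e; exists y => //; rewrite /= e TS.
  case: i => [|i].
    right; exists 1%N => //; exists F => //.
    by apply/seteqP; split => x /=; [case=> y Fy <-; rewrite /= ST|
      exists (T x)].
  left; exists i => //; exists F => //.
  by apply/seteqP; split => x /=; rewrite -iterS iterSr TS.
move=> mE; elim: n => [|n IH].
  by rewrite (_ : _ @` E = E)//; apply/seteqP; split=> x /=;
    [case=> y Ey <-|exists x].
rewrite (_ : _ @` E = T @^-1` (iter n S @` E)).
  by rewrite -[_ @^-1` _]setTI; exact: mT.
apply/seteqP; split=> x /=; first by case=> y Ey <-; exists y => //; rewrite ST.
by case=> y Ey e; exists y => //; rewrite e TS.
Qed.

Lemma measurable0B (E : set X) :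
  measurable (E : set X0) -> measurable (E : set XB).
Proof.
apply: smallest_sub E; first exact: smallest_sigma_algebra.
by move=> E EA; apply: sub_sigma_algebra; left.
Qed.

Lemma measurable_iter0 n (E : set X0) :
  measurable E -> measurable (iter n S @^-1` E : set X0).
Proof.
move=> mE; elim: n => // n IH.
rewrite (_ : _ @^-1` E = S @^-1` (iter n S @^-1` E)).
  by rewrite -[_ @^-1` _]setTI; exact: measurable_shift0.
by apply/seteqP; split => x; rewrite /= -iterSr.
Qed.

Lemma measurable_iterB n (E : set XB) :
  measurable E -> measurable (iter n S @^-1` E : set XB).
Proof.
move=> mE; elim: n => // n IH.
rewrite (_ : _ @^-1` E = S @^-1` (iter n S @^-1` E)).
  by rewrite -[_ @^-1` _]setTI; exact: measurable_shiftB.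
by apply/seteqP; split => x; rewrite /= -iterSr.
Qed.

Lemma sigma_neg_measurable n E :
  sigma_neg S A n E -> measurable (E : set XB).
Proof. by case=> F mF <-; apply: measurable_image_iterB; apply: measurable0B. Qed.

Lemma sigma_neg_le n m E :
  (n <= m)%N -> sigma_neg S A n E -> sigma_neg S A m E.
Proof.
move=> /subnKC nm /sigma_negP mE; apply/sigma_negP; rewrite -nm.
have {}mE := measurable_iter0 (m - n) mE.
rewrite (_ : _ @^-1` E = iter (m - n) S @^-1` (iter n S @^-1` E))//.
by apply/seteqP; split => x; rewrite /= iterD.
Qed.

Lemma sigma_neg_image n E :
  measurable (E : set X0) -> sigma_neg S A n (iter n S @` E).
Proof. by move=> mE; exists E. Qed.

Lemma sigma_negT n : sigma_neg S A n [set: X].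
Proof. by apply/sigma_negP; rewrite preimage_setT. Qed.

Lemma sigma_neg0 n : sigma_neg S A n set0.
Proof. by apply/sigma_negP; rewrite preimage_set0. Qed.

Lemma sigma_negI n E F :
  sigma_neg S A n E -> sigma_neg S A n F -> sigma_neg S A n (E `&` F).
Proof. by move=> /sigma_negP mE /sigma_negP mF; exact/sigma_negP/measurableI. Qed.

Lemma sigma_negC n E : sigma_neg S A n E -> sigma_neg S A n (~` E).
Proof. by move=> /sigma_negP mE; exact/sigma_negP/measurableC. Qed.

Lemma sigma_neg_bigcup n (P : set nat) (F : nat -> set X) :
  (forall k, P k -> sigma_neg S A n (F k)) ->
  sigma_neg S A n (\bigcup_(k in P) F k).
Proof.
move=> mF; apply/sigma_negP; rewrite preimage_bigcup.
by apply: bigcup_measurable => k Pk; exact/sigma_negP/mF.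
Qed.

(** Preimages of sets of [A] lie in [A_0] itself, and the image [S^i F] lies in [A_(-i)]. A
    sigma-algebra containing every [sigma_neg S A n] therefore contains [B]. *)
Lemma genB_sigma_neg E : genB S A E -> exists n, sigma_neg S A n E.
Proof.
move=> [[i _ [F AF <-]]|[i _ [F AF <-]]]; [exists 0%N|exists i].
  by apply/sigma_negP; apply: sub_sigma_algebra; exists i => //; exists F.
apply: sigma_neg_image; apply: sub_sigma_algebra; exists 0%N => //.
by exists F.
Qed.

End filtration.

(** * The outer measure associated with covers *)

Section cover_outer_measure.
#[local] Set Implicit Arguments.
#[local] Unset Strict Implicit.
Context (X : pointedType) (R : realType) (S : X -> X) (A : set (set X)).
Hypothesis S_bij : bijective S.
Local Notation X0 := (sigma0 S A).
Local Notation XB := (sigmaB S A).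

(** With [nu] equal to [phi0] this is [Phi], and with the integral of [Z^alpha] it is [Halpha].
    Leaving [nu] a bare set function admits measures on [B] as well. *)
Definition cover_inf (nu : set X -> \bar R) (Q : set X) : \bar R :=
  ereal_inf [set cover_sum S nu E | E in covers S A Q].

Lemma cover_inf_le nu Q E :
  covers S A Q E -> cover_inf nu Q <= cover_sum S nu E.
Proof. by move=> QE; apply: ereal_inf_lbound; exists E. Qed.

Variable nu : {measure set X0 -> \bar R}.

Lemma cover_sum_ge0 E : 0 <= cover_sum S nu E.
Proof. exact: nneseries_ge0. Qed.

Lemma cover_inf_ge0 Q : 0 <= cover_inf nu Q.
Proof. by apply: le_ereal_inf_tmp => _ [E _ <-]; exact: cover_sum_ge0. Qed.

Lemma cover_inf_subset P Q : P `<=` Q -> cover_inf nu P <= cover_inf nu Q.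
Proof.
move=> PQ; apply: le_ereal_inf_tmp => _ [E [mE QE] <-].
by apply: cover_inf_le; split => //; exact: subset_trans QE.
Qed.

(** The cover has [W] at index [n] and empty sets elsewhere. *)
Lemma cover_inf_sigma_neg n W :
  sigma_neg S A n W -> cover_inf nu W <= nu (iter n S @^-1` W).
Proof.
move=> nW; pose E k := if k == n then W else set0.
have -> : nu (iter n S @^-1` W) = cover_sum S nu E.
  rewrite /cover_sum (nneseriesD1 (n := n))//= /E eqxx eseries0 ?adde0//.
  by move=> k _ /negPf ->; rewrite preimage_set0 measure0.
apply: cover_inf_le; split => [k|x Wx]; last by exists n => //; rewrite /E eqxx.
by rewrite /E; case: eqP => [->//|_]; exact: sigma_neg0.
Qed.

Lemma cover_inf0 : cover_inf nu set0 = 0.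
Proof.
apply/eqP; rewrite eq_le cover_inf_ge0 andbT.
have := cover_inf_sigma_neg (sigma_neg0 A S_bij 0).
by rewrite preimage_set0 measure0.
Qed.

(** Near-optimal covers of the [Q n] are merged index by index: each [sigma_neg S A k] is closed
    under countable unions, so the union at index [k] is again admissible there. *)
Lemma cover_inf_sigma_subadditive : sigma_subadditive (cover_inf nu).
Proof.
move=> Q; have [[i ioo]|] := pselect (exists i, cover_inf nu (Q i) = +oo).
  rewrite (eseries_pinfty _ _ ioo) ?leey// => n _.
  by rewrite -ltNye (lt_le_trans _ (cover_inf_ge0 _)).
move=> /forallNP Qoo; apply/lee_addgt0Pr => e e0.
rewrite (le_trans _ (epsilon_trick _ _ (ltW e0)))//; last first.
  by move=> n; exact: cover_inf_ge0.
pose P n E := covers S A (Q n) E /\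
  cover_sum S nu E <= cover_inf nu (Q n) + (e / (2 ^ n.+1)%:R)%:E.
have [G PG] : {G : nat -> nat -> set X & forall n, P n (G n)}.
  apply: (@choice _ _ P) => n.
  have en : (0 < e / (2 ^ n.+1)%:R)%R by rewrite divr_gt0// ltr0n expn_gt0.
  have fQ : cover_inf nu (Q n) \is a fin_num.
    by rewrite ge0_fin_numE ?cover_inf_ge0// ltey; exact/eqP/Qoo.
  by have [_ [E QE <-] /ltW ?] := lb_ereal_inf_adherent en fQ; exists E.
have mG n k : measurable (iter k S @^-1` (G n k) : set X0).
  by apply/sigma_negP => //; exact: (PG n).1.1.
pose F k := \bigcup_n G n k.
apply: (@le_trans _ _ (cover_sum S nu F)).
  apply: cover_inf_le; split => [k|x [n _ Qx]].
    by apply: sigma_neg_bigcup => // n _; apply: (PG n).1.1.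
  by have [k _ Gx] := (PG n).1.2 x Qx; exists k => //; exists n.
apply: (@le_trans _ _ (\sum_(0 <= n <oo) cover_sum S nu (G n))); last first.
  by apply: lee_nneseries => [n _ _|n _]; [exact: cover_sum_ge0|exact: (PG n).2].
rewrite /cover_sum nneseries_interchange//.
apply: lee_nneseries => // k _; rewrite /F preimage_bigcup.
by apply: measure_sigma_subadditive => //; exact: bigcup_measurable.
Qed.

Definition cover_outer : {outer_measure set X -> \bar R} :=
  HB.pack (cover_inf nu) (isOuterMeasure.Build R X (cover_inf nu)
    cover_inf0 cover_inf_ge0 cover_inf_subset cover_inf_sigma_subadditive).

Lemma cover_infU P Q :
  cover_inf nu (P `|` Q) <= cover_inf nu P + cover_inf nu Q.
Proof. exact: (outer_measureU2 cover_outer). Qed.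

End cover_outer_measure.
Arguments cover_inf {X R} S A nu Q.

(** * Outer measures of covers for shift-invariant measures on [B] *)

Section invariant_measures.
#[local] Set Implicit Arguments.
#[local] Unset Strict Implicit.
Context (X : pointedType) (R : realType) (S : X -> X) (A : set (set X)).
Hypothesis S_bij : bijective S.
Local Notation X0 := (sigma0 S A).
Local Notation XB := (sigmaB S A).
Variable mu : {measure set XB -> \bar R}.

Let id0 (x : XB) : X0 := x.

Lemma measurable_id0 : measurable_fun [set: XB] id0.
Proof. by move=> _ B mB; rewrite setTI; exact: measurable0B mB. Qed.

(** The restriction to [A_0] is taken as a pushforward under the identity, so that it is a measure
    by construction. *)
Definition restrict0 : {measure set X0 -> \bar R} :=
  measure_function_pushforward__canonical__measure_function_Measure mu measurable_id0.

Hypothesis mu_inv : measure_invariant (S : XB -> XB) mu.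

Lemma invariant_iter n (E : set XB) :
  measurable E -> mu (iter n S @^-1` E) = mu E.
Proof.
move=> mE; elim: n => // n <-.
rewrite -[RHS]mu_inv; last exact: measurable_iterB.
by congr (mu _); apply/seteqP; split => x; rewrite /= -iterSr.
Qed.

Lemma cover_sum_invariant E : (forall n, sigma_neg S A n (E n)) ->
  cover_sum S mu E = \sum_(0 <= n <oo) mu (E n).
Proof.
move=> mE; apply: eq_eseriesr => n _; apply: invariant_iter.
exact: sigma_neg_measurable (mE n).
Qed.

(** By invariance the cost of a cover is the sum of the measures of its members, which countable
    subadditivity bounds from below. *)
Lemma cover_inf_invariant_ge (Q : set XB) :
  measurable Q -> mu Q <= cover_inf S A mu Q.
Proof.
move=> mQ; apply: le_ereal_inf_tmp => _ [E [mE QE] <-].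
rewrite cover_sum_invariant//; apply: measure_sigma_subadditive => // n.
exact: sigma_neg_measurable (mE n).
Qed.

Lemma cover_inf_invariant_le n W :
  sigma_neg S A n W -> cover_inf S A mu W <= mu W.
Proof.
move=> nW; rewrite -(invariant_iter n (sigma_neg_measurable S_bij nW)).
exact: (cover_inf_sigma_neg S_bij restrict0).
Qed.

(** Splitting every member of a cover along [C] gives pieces in [sigma_neg S A (maxn n k)], on which
    the outer measure is at most [mu]; additivity of [mu] recombines them. *)
Lemma sigma_neg_caratheodory n C : sigma_neg S A n C ->
  caratheodory_measurable (cover_inf S A mu) C.
Proof.
move=> nC; apply: (@le_caratheodory_measurable _ _ (cover_outer S_bij restrict0)).
move=> Q; apply: le_ereal_inf_tmp => _ [E [mE QE] <-].
have mEB k : measurable (E k : set XB) by exact: sigma_neg_measurable (mE k).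
have mCB : measurable (C : set XB) by exact: sigma_neg_measurable nC.
have sub D : sigma_neg S A n D ->
    cover_inf S A mu (Q `&` D) <= \sum_(0 <= k <oo) mu (E k `&` D).
  move=> nD; apply: (@le_trans _ _ (cover_inf S A mu (\bigcup_k (E k `&` D)))).
    apply: (cover_inf_subset restrict0).
    by rewrite -setI_bigcupl; exact: setSI.
  apply: (le_trans (cover_inf_sigma_subadditive S_bij restrict0 _)).
  apply: lee_nneseries => [k _ _|k _]; first exact: (cover_inf_ge0 restrict0).
  apply: (@cover_inf_invariant_le (maxn n k)); apply: sigma_negI => //.
    by apply: sigma_neg_le (mE k) => //; exact: leq_maxr.
  by apply: sigma_neg_le nD => //; exact: leq_maxl.
apply: le_trans (leeD (sub _ nC) (sub _ (sigma_negC S_bij nC))) _.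
rewrite -nneseriesD// [leRHS]cover_sum_invariant//.
apply: lee_nneseries => [k _ _|k _]; first by rewrite adde_ge0.
rewrite -measureU//.
- by rewrite -setIUr setUv setIT.
- exact: measurableI.
- by apply: measurableI => //; exact: measurableC.
- by rewrite setIACA setICr setI0.
Qed.

(* Both [cover_inf mu] and [mu] are additive on {Q, ~Q}, with the same finite
   total mass, so the inequality [mu <= cover_inf mu] has to be an equality. *)
Lemma cover_inf_invariant (Q : set XB) : mu [set: X] < +oo ->
  measurable Q -> cover_inf S A mu Q = mu Q.
Proof.
move=> muoo mQ; apply/eqP; rewrite eq_le cover_inf_invariant_ge// andbT.
pose H := cover_outer S_bij restrict0.
(* Caratheodory measurable sets form a sigma-algebra, and each generator of [B] lies in some
   [sigma_neg S A n]. *)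
have CQ : caratheodory_measurable H Q.
  apply: (smallest_sub (sigma_algebra_measurable (caratheodory_type H)) _ mQ).
  by move=> E /(genB_sigma_neg S_bij)[n /sigma_neg_caratheodory].
have /(_ setT) := CQ; rewrite !setTI => HT.
have muC := measureU mu mQ (measurableC mQ) (setICr Q).
rewrite setUv in muC.
have HTle : H setT <= mu setT.
  by apply: (@cover_inf_invariant_le 0); exact: sigma_negT.
have HCge : mu (~` Q) <= H (~` Q).
  by apply: cover_inf_invariant_ge; exact: measurableC.
have fC : mu (~` Q) \is a fin_num.
  rewrite ge0_fin_numE//; apply: le_lt_trans muoo.
  by apply: le_measure => //; rewrite inE//; exact: measurableC.
rewrite -(leeD2rE _ _ fC) -[leRHS]muC; apply: le_trans HTle.
by rewrite HT; exact: leeD2l.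
Qed.

End invariant_measures.

(** * Null sets and ergodic measures *)

(** The epsilon-delta form of absolute continuity follows by viewing [nu] as a charge, whose
    variation is controlled through a Hahn decomposition. *)
Lemma dominates_eps_delta d (T : measurableType d) (R : realType)
    (nu : {finite_measure set T -> \bar R}) (mu : {measure set T -> \bar R}) :
  (forall E, measurable E -> mu E = 0 -> nu E = 0) ->
  forall e : R, (0 < e)%R -> exists2 r : R, (0 < r)%R &
    forall E, measurable E -> mu E < r%:E -> nu E < e%:E.
Proof.
move=> numu e e0; have [P [N PN]] := Hahn_decomposition (charge_of_finite_measure nu).
have dom : charge_of_finite_measure nu `<< mu by exact/null_content_dominatesP.
have [r [r0 H]] := charge_variation_continuous PN dom e0.
exists r => // E mE mur; apply: le_lt_trans (H E mE mur).
apply: le_trans (abse_charge_variation PN mE).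
exact: lee_abs.
Qed.

Section ergodic_measures.
#[local] Set Implicit Arguments.
#[local] Unset Strict Implicit.
Context (X : pointedType) (R : realType) (S : X -> X) (A : set (set X)).
Hypothesis S_bij : bijective S.
Local Notation X0 := (sigma0 S A).
Local Notation XB := (sigmaB S A).
Variable mu : {measure set XB -> \bar R}.
Hypothesis mu_inv : measure_invariant (S : XB -> XB) mu.
Hypothesis mu_fin : mu [set: X] < +oo.

(* Since the algebras [sigma_neg S A n] increase, the members of a cover of
   [N] can be grouped into blocks lying arbitrarily far out in the sequence,
   each of [mu]-measure as small as required by absolute continuity. *)
Lemma cover_inf_null (nu : {finite_measure set X0 -> \bar R}) (N : set XB) :
  (forall E : set X0, measurable E -> mu E = 0 -> nu E = 0) ->
  measurable N -> mu N = 0 -> cover_inf S A nu N = 0.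
Proof.
move=> numu mN muN0; apply/eqP; rewrite eq_le cover_inf_ge0 andbT.
apply/lee_addgt0Pr => e e0; rewrite add0e.
have ek k : (0 < e / (2 ^ k.+1)%:R)%R by rewrite divr_gt0// ltr0n expn_gt0.
have /choice[r rP] : forall k, exists r : R, (0 < r)%R /\
    forall E : set X0, measurable E -> mu E < r%:E ->
      nu E < (e / (2 ^ k.+1)%:R)%:E.
  by move=> k; have [r r0 H] :=
    @dominates_eps_delta _ _ R nu (restrict0 mu) numu _ (ek k); exists r.
have : cover_inf S A mu N < (r 0%N)%:E.
  by rewrite cover_inf_invariant// muN0 lte_fin (rP 0%N).1.
move=> /ereal_inf_lt[_ [E [nE NE] <-]]; rewrite cover_sum_invariant// => Er.
have mE n : measurable (E n : set XB) by exact: sigma_neg_measurable (nE n).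
have /choice[m mP] : forall k, exists n, (k <= n)%N /\
    \sum_(n <= i <oo) mu (E i) < (r k)%:E.
  move=> k; have Eoo : \sum_(0 <= i <oo) mu (E i) < +oo.
    exact: lt_trans Er (ltry _).
  have /(_ (fun i _ => measure_ge0 mu _)) tail := nneseries_tail_cvg Eoo.
  have rk : (0 : \bar R) < (r k)%:E by rewrite lte_fin (rP k).1.
  have [n0 _ n0P] := tail _ (open_ereal_lt_ereal rk).
  by exists (maxn k n0); rewrite leq_maxl; split => //; apply: n0P; exact: leq_maxr.
(* The total mass of the cover is below [r 0], so the first block may start at index 0. The cut
   points need not increase: an index [i] falls in the block of the least [k] with [i < l k.+1]. *)
pose l k := if k is 0%N then 0%N else m k.
have lr k : \sum_(l k <= i <oo) mu (E i) < (r k)%:E.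
  by case: k => [//|k]; exact: (mP k.+1).2.
pose W k := \bigcup_(i in [set i | (l k <= i < l k.+1)%N]) E i.
have nW k : sigma_neg S A (l k.+1) (W k).
  apply: sigma_neg_bigcup => // i /andP[_ il].
  by apply: sigma_neg_le (nE i) => //; exact: ltnW.
have muW k : mu (W k) < (r k)%:E.
  apply: le_lt_trans (lr k); apply: measure_sigma_subadditive_tail => //.
    exact: sigma_neg_measurable (nW k).
  by apply: bigcup_subset => i /= /andP[li _]; apply/negP; rewrite -leqNgt.
apply: le_trans (epsilon_trick0 xpredT (ltW e0)).
apply: (@le_trans _ _ (cover_inf S A nu (\bigcup_k W k))).
  apply: cover_inf_subset => x /NE[i _ Eix].
  have il : exists k, (i < l k.+1)%N by exists i; exact: (mP i.+1).1.
  have := ex_minnP il; case=> k ik kmin; exists k => //; exists i => //=.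
  rewrite ik andbT leqNgt; case: k kmin {ik} => // k kmin.
  by apply/negP => /kmin; rewrite ltnn.
apply: le_trans (cover_inf_sigma_subadditive S_bij nu W) _.
apply: lee_nneseries => [k _ _|k _]; first exact: cover_inf_ge0.
(* Invariance carries the smallness of [mu (W k)] over to the pull-back of [W k] in [A_0], where the
   choice of [r k] applies. *)
apply: le_trans (cover_inf_sigma_neg S_bij nu (nW k)) _.
apply/ltW/(rP k).2; first by apply/sigma_negP.
by rewrite invariant_iter//; exact: sigma_neg_measurable (nW k).
Qed.

(** The points whose backward orbit meets [D] infinitely often. *)
Definition visits (D : set X) : set X := lim_sup_set (fun k => iter k S @` D).

Lemma shift_visits D : S @^-1` (visits D) = visits D.
Proof.
apply/seteqP; split => x Tx n _ /=.
  have [[//|k] /= nk [y Dy Sy]] := Tx n.+1 I.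
  by exists k => //; exists y => //; apply: (bij_inj S_bij).
have [k /= nk [y Dy <-]] := Tx n I.
by exists k.+1; [exact: leqW|exists y].
Qed.

Variable D : set X0.
Hypothesis mD : measurable D.

Lemma measurable_visits : measurable (visits D : set XB).
Proof.
apply: bigcap_measurable => [|n _]; first by exists 0%N.
apply: bigcup_measurable => k _; apply: measurable_image_iterB => //.
exact: measurable0B.
Qed.

(** All [S^k D] have the measure of [D], and by continuity from above for a finite measure this
    bound survives in the upper limit. *)
Lemma visits_ge : mu D <= mu (visits D).
Proof.
have mI k : measurable (iter k S @` D : set XB).
  by apply: measurable_image_iterB => //; exact: measurable0B.
have muI k : mu (iter k S @` D) = mu D.
  by rewrite -(invariant_iter S_bij mu_inv k (mI k)) image_iterK.
have fin : mu (\bigcup_(k in [set k | (0 <= k)%N]) (iter k S @` D)) < +oo.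
  by apply: le_lt_trans mu_fin; apply: le_measure; rewrite ?inE//;
    exact: bigcup_measurable.
have /cvg_lim <-// := lim_sup_set_cvg mu _ mI fin.
apply: lime_ge; first by apply/cvg_ex; exists (mu (visits D)); exact: lim_sup_set_cvg.
apply: nearW => n; rewrite -(muI n); apply: le_measure; rewrite ?inE//.
  exact: bigcup_measurable.
by move=> x Dx; exists n => /=.
Qed.

Hypothesis mu_erg : measure_ergodic (S : XB -> XB) mu.

(** The set [visits D] is invariant, so ergodicity leaves only measure zero, excluded by
    [visits_ge], or full measure. *)
Lemma visits_full : 0 < mu D -> mu (~` visits D) = 0.
Proof.
move=> muD; have [T0|//] := mu_erg.2 _ measurable_visits (shift_visits D).
by have := lt_le_trans muD visits_ge; rewrite T0 ltxx.
Qed.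

Variables (nu : {measure set X0 -> \bar R}) (K : R).
Hypothesis K_gt0 : (0 < K)%R.
Hypothesis nu_le : forall E : set X0, measurable E -> E `<=` D ->
  nu E <= K%:E * mu E.

(* Every point of [visits D] lies in [iter k S @` D] for some [k >= n], so [W]
   splits, up to a complement of [visits D], into pieces [S^k B_k] with
   [B_k] contained in [D]. *)
Lemma cover_inf_visits_sigma_neg n W : sigma_neg S A n W ->
  cover_inf S A nu (W `&` visits D) <= K%:E * mu W.
Proof.
move=> nW; pose F j : set X := iter (n + j) S @` D.
have nF j : sigma_neg S A (n + j) (F j) by exact: sigma_neg_image.
(* [seqDU] keeps only the first visit at or after time [n], so the pieces are disjoint and their
   measures sum to at most [mu W]. *)
pose P j := W `&` seqDU F j.
have nP j : sigma_neg S A (n + j) (P j).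
  apply: sigma_negI => //; first by apply: sigma_neg_le nW => //; exact: leq_addr.
  rewrite /seqDU setDE; apply: sigma_negI => //; apply: sigma_negC => //.
  rewrite -bigcup_mkord; apply: sigma_neg_bigcup => // i /= ij.
  by apply: sigma_neg_le (nF i) => //; rewrite leq_add2l ltnW.
have mP j : measurable (P j : set XB) by exact: sigma_neg_measurable (nP j).
have mW : measurable (W : set XB) by exact: sigma_neg_measurable nW.
apply: (@le_trans _ _ (cover_inf S A nu (\bigcup_j P j))).
  apply: cover_inf_subset; rewrite /P -setI_bigcupr -seqDU_bigcup_eq.
  apply: setIS => x /(_ n I)[k /= nk Fx]; exists (k - n)%N => //.
  by rewrite /F subnKC.
apply: le_trans (cover_inf_sigma_subadditive S_bij nu P) _.
apply: (@le_trans _ _ (K%:E * \sum_(0 <= j <oo) mu (P j))).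
  rewrite -nneseriesZl//; apply: lee_nneseries => [j _ _|j _].
    exact: cover_inf_ge0.
  apply: le_trans (cover_inf_sigma_neg S_bij nu (nP j)) _.
  rewrite -(invariant_iter S_bij mu_inv (n + j) (mP j)); apply: nu_le.
    by apply/sigma_negP.
  move=> x [_ [Fx _]]; rewrite -(image_iterK S_bij (n + j) D); exact: Fx.
rewrite lee_pmul2l// -measure_semi_bigcup//; last 2 first.
- exact/trivIset_setIl/trivIset_seqDU.
- exact: bigcup_measurable.
apply: le_measure; rewrite ?inE//; first exact: bigcup_measurable.
by move=> x [j _ []].
Qed.

(** The bound for one set is summed over an arbitrary cover of [Q]; the infimum over covers is then
    [K * mu Q], since the outer measure of [mu] agrees with [mu] on [B]. *)
Lemma cover_inf_visits (Q : set XB) : measurable Q ->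
  cover_inf S A nu (Q `&` visits D) <= K%:E * mu Q.
Proof.
move=> mQ; rewrite -lee_pdivrMl// -(cover_inf_invariant S_bij mu_inv)//.
apply: le_ereal_inf_tmp => _ [E [nE QE] <-].
rewrite lee_pdivrMl// cover_sum_invariant// -nneseriesZl//.
apply: (@le_trans _ _ (cover_inf S A nu (\bigcup_n (E n `&` visits D)))).
  by apply: cover_inf_subset; rewrite -setI_bigcupl; exact: setSI.
apply: le_trans (cover_inf_sigma_subadditive S_bij nu _) _.
apply: lee_nneseries => [k _ _|k _]; first exact: cover_inf_ge0.
exact: cover_inf_visits_sigma_neg.
Qed.

End ergodic_measures.

(** * Mutual singularity of the ergodic components *)

(* [is_RN_derivative] does not require the density to be nonnegative. *)
Lemma is_RN_derivative_max0 d (T : measurableType d) (R : realType)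
    (mu nu : {measure set T -> \bar R}) (f : T -> \bar R) :
  is_RN_derivative mu nu f ->
  is_RN_derivative mu nu (fun x => maxe (f x) 0) /\ nu [set x | f x < 0] = 0.
Proof.
move=> [mf fE]; set N := [set x | f x < 0].
have mN : measurable N.
  by rewrite -[N]setTI; exact: emeasurable_fun_infty_o.
have mg : measurable_fun [set: T] (fun x => maxe (f x) 0).
  exact: measurable_maxe.
(* On [N] the integral is at most zero, whereas a measure is at least zero. *)
have nu0 E : measurable E -> E `<=` N -> nu E = 0.
  move=> mE EN; apply/eqP; rewrite eq_le measure_ge0 andbT fE//.
  under eq_integral do rewrite -[f _]oppeK.
  rewrite integral_ge0N => [|x /EN/ltW]; last by rewrite oppe_ge0.
  by rewrite oppe_le0; apply: integral_ge0 => x /EN/ltW; rewrite oppe_ge0.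
split; last exact: nu0.
split=> // E mE.
have mEN : measurable (E `&` N) by exact: measurableI.
have mEC : measurable (E `\` N) by exact: measurableD.
have dE : E = (E `&` N) `|` (E `\` N) by rewrite setUIDK.
have dis : [disjoint E `&` N & E `\` N].
  by apply/eqP; rewrite setDE setIACA setICr setI0.
have -> : nu E = nu (E `\` N).
  rewrite {1}dE; apply: etrans (measureU nu mEN mEC _) _; first exact/eqP.
  have e0 := nu0 _ mEN (@subIsetr _ E N).
  by apply: etrans (congr1 (fun y => y + nu (E `\` N)) e0) _; rewrite add0e.
rewrite [in RHS]dE ge0_integral_setU//; last 2 first.
- exact: measurable_funTS.
- by move=> x _; rewrite le_max lexx orbT.
rewrite [X in _ = X + _]integral0_eq ?add0e; last first.
  by move=> x [_ /ltW fx]; apply/max_idPr.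
rewrite fE//; apply: eq_integral => x /[!inE] -[_ /negP].
by rewrite -leNgt => fx; apply/esym/max_idPl.
Qed.

Section ergodic_components.
#[local] Set Implicit Arguments.
#[local] Unset Strict Implicit.
Context (X : pointedType) (R : realType) (S : X -> X) (A : set (set X)).
Hypothesis S_bij : bijective S.
Local Notation X0 := (sigma0 S A).
Local Notation XB := (sigmaB S A).
Variables (phi0 : {finite_measure set X0 -> \bar R}) (I : countType).
Variables (P : I -> probability XB R) (f : I -> X0 -> \bar R).
Hypothesis P_distinct : forall i j : I, i <> j ->
  exists2 E : set XB, measurable E & P i E <> P j E.
Hypothesis P_ergodic : forall i, measure_ergodic (S : XB -> XB) (P i).
Hypothesis f_ge0 : forall i x, 0 <= f i x.
Hypothesis f_RN : forall i, is_RN_derivative phi0 (P i) (f i).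

Let mf i : measurable_fun [set: X0] (f i) := (f_RN i).1.

Let measurable_le_density i j : measurable [set x : X0 | f j x <= f i x].
Proof. by rewrite -[X in measurable X]setTI; exact: measurable_lee. Qed.

(* Comparing the densities on a single set of positive measure is enough to
   compare the two measures everywhere, by [cover_inf_visits]. *)
Lemma ergodic_density_le i j : i <> j -> P j [set x | f j x <= f i x] = 0.
Proof.
move=> ij; set D := [set x | _]; apply: contrapT => /eqP PjD.
have mD : measurable (D : set X0) := measurable_le_density i j.
have {}PjD : 0 < P j D by rewrite lt0e PjD measure_ge0.
have Ple (E : set X0) : measurable E -> E `<=` D -> P j E <= P i E.
  move=> mE ED; rewrite (f_RN j).2// (f_RN i).2//.
  apply: ge0_le_integral => //.
  - exact: measurable_funTS (mf j).
  - exact: measurable_funTS (mf i).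
have PiD : 0 < P i D by apply: lt_le_trans PjD (Ple _ mD _).
have fin k : P k [set: X] < +oo by rewrite probability_setT ltry.
(* Under [P j] almost every point lies in [visits S D]. On that part the outer measure of [P j] is
   bounded through the ergodic measure [P i], with constant 1. *)
have PB (Q : set XB) : measurable Q -> P j Q <= P i Q.
  move=> mQ; have mV := measurable_visits S_bij mD.
  have PjV : P j (~` visits S D) = 0.
    exact: (visits_full S_bij (P_ergodic j).1 (fin j) mD (P_ergodic j) PjD).
  have -> : P j Q = P j (Q `&` visits S D).
    have mQV : measurable (Q `\` visits S D) by exact: measurableD.
    have QV0 : P j (Q `\` visits S D) = 0.
      exact: (subset_measure0 _ (measurableC mV) _ PjV).
    by rewrite [LHS](measureDI (P j) mQ mV) [X in X + _]QV0 add0e.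
  apply: (le_trans (cover_inf_invariant_ge S_bij (P_ergodic j).1 (measurableI _ _ mQ mV))).
  rewrite -[leRHS]mul1e.
  apply: (cover_inf_visits S_bij (P_ergodic i).1 (fin i) mD (nu := restrict0 (P j))) => //.
  by move=> E mE ED; rewrite mul1e; exact: Ple.
(* Applied to complements as well, the inequality between two probability measures becomes an
   equality, contrary to distinctness. *)
have [E mE] := P_distinct ij; apply; apply/eqP; rewrite eq_le PB// andbT.
have /= := PB _ (measurableC mE); rewrite !probability_setC//.
by rewrite leeD2lE// leeN2.
Qed.

(** Indexing by [nat] through [unpickle] makes the union over the countable type [I] the union of a
    sequence; [i] itself and numbers that code no index contribute nothing. *)
Definition dominated i n : set X0 :=
  if unpickle n is Some j then
    if j == i then set0 else [set x | f i x <= f j x]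
  else set0.

Definition dominant i : set X0 := ~` \bigcup_n dominated i n.

Lemma measurable_dominant i : measurable (dominant i).
Proof.
apply/measurableC/bigcup_measurable => n _; rewrite /dominated.
by case: unpickle => // j; case: ifP.
Qed.

Lemma dominantP i j x : dominant i x -> i <> j -> f j x < f i x.
Proof.
move=> Gx ij; rewrite ltNge; apply/negP => fij; apply: Gx.
exists (pickle j) => //; rewrite /dominated pickleK.
by case: eqP => // ji; apply: ij.
Qed.

Lemma dominant_disjoint i j : i <> j -> dominant i `&` dominant j = set0.
Proof.
move=> ij; apply/seteqP; split => // x [/dominantP/(_ ij) fji].
move=> /dominantP/(_ (nesym ij)) /(lt_trans fji).
by rewrite ltxx.
Qed.

Lemma dominant_full i : P i (~` dominant i) = 0.
Proof.
have mD n : measurable (dominated i n : set X0).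
  by rewrite /dominated; case: unpickle => // j; case: ifP.
apply/eqP; rewrite eq_le measure_ge0 andbT /dominant setCK.
have mDB n : measurable (dominated i n : set XB) by exact: measurable0B (mD n).
apply: (le_trans (measure_sigma_subadditive (P i) mDB _ (@subset_refl _ _))).
  exact: bigcup_measurable.
rewrite eseries0// => n _ _; rewrite /dominated.
case: unpickle => [j|]; last exact: measure0.
case: eqP => [_|ji]; first exact: measure0.
exact: ergodic_density_le.
Qed.

End ergodic_components.

(** * Disjoint sets carrying the ergodic components of [Lambda] *)

Section components_of_Lambda.
#[local] Set Implicit Arguments.
#[local] Unset Strict Implicit.
Context (X : pointedType) (R : realType) (S : X -> X) (A : set (set X)).
Hypothesis S_bij : bijective S.
Local Notation X0 := (sigma0 S A).
Local Notation XB := (sigmaB S A).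
Variables (phi0 Lam : {finite_measure set X0 -> \bar R}).
Variables (LamB : {measure set XB -> \bar R}) (Z : X0 -> \bar R).
Hypothesis Z_ge0 : forall x, 0 <= Z x.
Hypothesis Z_RN : is_RN_derivative phi0 Lam Z.
Hypothesis LamB_ext : forall E : set X0, measurable E -> LamB E = Lam E.
Variables (I : countType) (lam : I -> R) (P : I -> probability XB R).
Hypothesis lam_gt0 : forall i, (0 < lam i)%R.
Hypothesis P_distinct : forall i j : I, i <> j ->
  exists2 E : set XB, measurable E & P i E <> P j E.
Hypothesis P_ergodic : forall i, measure_ergodic (S : XB -> XB) (P i).
Hypothesis Lam_decomp : forall E : set XB, measurable E ->
  LamB E = \esum_(i in [set: I]) ((lam i)%:E * P i E).
Variables (f : I -> X0 -> \bar R) (M : I -> \bar R).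
Hypothesis f_ge0 : forall i x, 0 <= f i x.
Hypothesis f_RN : forall i, is_RN_derivative phi0 (P i) (f i).
Hypothesis M_ub : forall i, P i [set x | M i < f i x] = 0.
Hypothesis M_lub : forall i (c : R), c%:E < M i ->
  P i [set x | c%:E < f i x] <> 0.

Let lamP_ge0 E i : 0 <= (lam i)%:E * P i E.
Proof. by rewrite mule_ge0// lee_fin ltW. Qed.

Let mf i : measurable_fun [set: X0] (f i) := (f_RN i).1.
Let mZ : measurable_fun [set: X0] Z := Z_RN.1.
Let mlf i : measurable_fun [set: X0] (fun x => (lam i)%:E * f i x).
Proof. exact: measurable_funeM. Qed.

Lemma LamB_null (N : set XB) :
  measurable N -> (forall i, P i N = 0) -> LamB N = 0.
Proof. by move=> mN PN; rewrite Lam_decomp// esum1// => i _; rewrite PN mule0. Qed.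

Lemma Lam_null_component (E : set X0) i : measurable E -> Lam E = 0 -> P i E = 0.
Proof.
move=> mE LE; have := LamB_ext mE; rewrite LE Lam_decomp; last exact: measurable0B.
move=> e0; apply/eqP; rewrite eq_le measure_ge0 andbT.
rewrite -(@lee_pmul2l _ (lam i)%:E)// ?lte_fin// mule0 -e0.
apply: esum_ge; exists [set i]; last by rewrite fsbig_set1.
by split => //; exact: finite_set1.
Qed.

(** The other components vanish on [G], so a single term of the decomposition survives. *)
Lemma Lam_restrict_component i (G E : set X0) :
  (forall j, i <> j -> P j G = 0) -> measurable G ->
  measurable E -> E `<=` G -> Lam E = (lam i)%:E * P i E.
Proof.
move=> PG mG mE EG; rewrite -LamB_ext// Lam_decomp; last exact: measurable0B.
rewrite -[RHS](@esum_set1 _ _ i (fun j => (lam j)%:E * P j E))//.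
rewrite [RHS]esum_mkcond; apply: eq_esum => j _.
case: ifPn => // /negP ji; have ij : i <> j by move=> e; apply: ji; rewrite inE e.
have -> : P j E = 0; last by rewrite mule0.
apply: (@subset_measure0 _ _ _ (P j) E G) => //; last exact: PG.
  exact: measurable0B.
exact: measurable0B.
Qed.

Lemma dominant_null i j : i <> j -> P j (dominant f i) = 0.
Proof.
move=> ij; apply: (@subset_measure0 _ _ _ (P j) _ (~` dominant f j)).
- exact: measurable0B (measurable_dominant f_RN i).
- exact: measurable0B (measurableC (measurable_dominant f_RN j)).
- by move=> x Gi Gj; have := dominant_disjoint f ij;
    move=> /seteqP[/(_ x (conj Gi Gj))].
- exact: dominant_full.
Qed.

(** On [dominant f i] both functions are densities of [Lam] with respect to [phi0], so they agree
    [phi0]-almost everywhere; [P i], having a density, inherits the null set. *)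
Lemma dominant_density i :
  P i (dominant f i `&` [set x | Z x != (lam i)%:E * f i x]) = 0.
Proof.
have mG := measurable_dominant f_RN i; set N := _ `&` _.
have mN : measurable (N : set X0).
  by apply: measurableI => //; rewrite -[X in measurable X]setTI; exact: measurable_neqe.
have ZG : phi0.-integrable (dominant f i) Z.
  apply/integrableP; split; first exact: measurable_funTS.
  under eq_integral do rewrite gee0_abs//.
  by rewrite -Z_RN.2// ltey_eq fin_num_measure.
have ae : ae_eq phi0 (dominant f i) Z (fun x => (lam i)%:E * f i x).
  apply: integral_ae_eq => //; first exact: measurable_funTS.
  move=> E EG mE; rewrite -Z_RN.2// ge0_integralZl//; last 2 first.
  - exact: measurable_funTS.
  - by rewrite lee_fin ltW.
  rewrite -(f_RN i).2//; apply: Lam_restrict_component EG => //.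
  exact: dominant_null.
rewrite (f_RN i).2//; apply: null_set_integral => //; first exact: measurable_funTS.
have [B [mB B0 NB]] := ae; apply: (subset_measure0 mN mB _ B0).
by move=> x [Gx /eqP ne]; apply: NB => /(_ Gx).
Qed.

(* Compared with [dominant f i], only a [P i]-null set is removed, so that the
   relations between [Z], [f i] and [M i] hold everywhere on [component i]. *)
Definition component i : set X0 := dominant f i `&`
  ([set x | Z x = (lam i)%:E * f i x] `&` [set x | f i x <= M i] `&` [set x | 0 < Z x]).

Lemma measurable_component i : measurable (component i).
Proof.
apply: measurableI; first exact: measurable_dominant.
apply: measurableI; last first.
  by rewrite -[X in measurable X]setTI; exact: emeasurable_fun_o_infty.
apply: measurableI; last first.
  by rewrite -[X in measurable X]setTI; exact: emeasurable_fun_infty_c.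
by rewrite -[X in measurable X]setTI; exact: measurable_eqe.
Qed.

Lemma component_disjoint i j : i <> j -> component i `&` component j = set0.
Proof.
move=> ij; apply/seteqP; split => // x [[Gi _] [Gj _]].
have := dominant_disjoint f ij.
by move=> /seteqP[/(_ x (conj Gi Gj))].
Qed.

Lemma component_null i j : i <> j -> P j (component i) = 0.
Proof.
move=> ij; apply: (@subset_measure0 _ _ _ (P j) _ (dominant f i)).
- exact: measurable0B (measurable_component i).
- exact: measurable0B (measurable_dominant f_RN i).
- by move=> x [].
- exact: dominant_null.
Qed.

(** Each condition in the definition fails only on a [P i]-null set; for [0 < Z] the reason is that
    [{Z <= 0}] is [Lam]-null and [lam i] is positive. *)
Lemma component_full i : P i (~` component i) = 0.
Proof.
have mZ0 : measurable ([set x | Z x <= 0] : set X0).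
  by rewrite -[X in measurable X]setTI; exact: emeasurable_fun_infty_c.
have mM : measurable ([set x | M i < f i x] : set X0).
  by rewrite -[X in measurable X]setTI; exact: emeasurable_fun_o_infty.
have LZ0 : Lam [set x | Z x <= 0] = 0.
  rewrite Z_RN.2// integral0_eq// => x /= Zx.
  by apply/eqP; rewrite eq_le Zx Z_ge0.
have PZ0 := Lam_null_component i mZ0 LZ0.
have mD := measurable0B (measurableC (measurable_dominant f_RN i)).
have mC := measurable_component i.
have sub : ~` component i `<=` ~` dominant f i `|`
    (dominant f i `&` [set x | Z x != (lam i)%:E * f i x]) `|`
    ([set x | M i < f i x] `|` [set x | Z x <= 0]).
  move=> x Cx; have [Gx|] := pselect (dominant f i x); last by left; left.
  have [Zx|/eqP] := pselect (Z x = (lam i)%:E * f i x); last by left; right.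
  right; have [Zx0|] := ltP 0 (Z x); last by right.
  by left => /=; rewrite ltNge; apply/negP => fM; apply: Cx.
have mdd : measurable (dominant f i `&` [set x | Z x != (lam i)%:E * f i x] : set XB).
  apply: measurable0B; apply: measurableI; first exact: measurable_dominant.
  by rewrite -[X in measurable X]setTI; exact: measurable_neqe.
have mZ0B := measurable0B mZ0; have mMB := measurable0B mM.
apply: (@subset_measure0 _ _ _ (P i) _ _ _ _ sub).
- exact: measurable0B (measurableC mC).
- by apply: measurableU; exact: measurableU.
- apply: null_set_setU; [exact: measurableU|exact: measurableU| |].
    by apply: null_set_setU => //; [exact: dominant_full|exact: dominant_density].
  by apply: null_set_setU => //; exact: M_ub.
Qed.

Lemma Lam_component i (E : set X0) :
  measurable E -> E `<=` component i -> Lam E = (lam i)%:E * P i E.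
Proof.
by apply: Lam_restrict_component (measurable_component i) => j; exact: component_null.
Qed.

Lemma component_gt0 i x : component i x -> 0 < Z x.
Proof. by case=> _ []. Qed.

Lemma component_le i x : component i x -> Z x <= (lam i)%:E * M i.
Proof. by case=> _ [] [-> ?] _; rewrite lee_pmul2l// lte_fin. Qed.

(** On [component i] the condition [Z > lam i * c] amounts to [f i > c]. This supplies the sets to
    which recurrence is applied in the upper bound. *)
Lemma component_lub i (c : R) : c%:E < M i ->
  0 < P i (component i `&` [set x | (lam i * c)%:E < Z x]).
Proof.
move=> cM; rewrite lt0e measure_ge0 andbT; apply/eqP => P0.
have mC := measurable_component i.
have mc : measurable ([set x | c%:E < f i x] : set X0).
  by rewrite -[X in measurable X]setTI; exact: emeasurable_fun_o_infty.
have mlc : measurable ([set x | (lam i * c)%:E < Z x] : set X0).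
  by rewrite -[X in measurable X]setTI; exact: emeasurable_fun_o_infty.
have mI : measurable (component i `&` [set x | (lam i * c)%:E < Z x] : set XB).
  by apply: measurable0B; exact: measurableI.
have mCB : measurable (~` component i : set XB).
  by apply: measurable0B; exact: measurableC.
apply: (M_lub cM).
have sub : [set x | c%:E < f i x] `<=`
    (component i `&` [set x | (lam i * c)%:E < Z x]) `|` ~` component i.
  move=> x /= cf; have [Cx|] := pselect (component i x); last by right.
  left; split => //=; case: (Cx) => _ [[-> _] _].
  by rewrite EFinM lte_pmul2l// lte_fin.
apply: (@subset_measure0 _ _ _ (P i) _ _ _ _ sub).
- exact: measurable0B.
- exact: measurableU.
- by apply: null_set_setU => //; exact: component_full.
Qed.

End components_of_Lambda.

(** * Powers of the density *)

Section power_inequalities.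
Context {R : realType}.
Implicit Types (l c a : R) (z m x L : \bar R).

(** Writing [z^a] as [z / z^(1 - a)] reduces both power bounds below to the monotonicity of
    [z^(1 - a)]. *)
Let powR_1B (z a : R) : (0 < z)%R -> (z `^ a = (z `^ (1 - a))^-1 * z)%R.
Proof.
move=> z0; rewrite -powRN opprB -[X in (_ * X)%R]powRr1 ?ltW// -powRD ?subrK//.
by apply/implyP => _; rewrite gt_eqF.
Qed.

Let powR_const (l c z a : R) : (0 < l)%R -> (0 < c)%R ->
  (l `^ a * (c^-1) `^ (1 - a) * (l^-1 * z) = ((l * c) `^ (1 - a))^-1 * z)%R.
Proof.
move=> l0 c0; rewrite (powR_1B _ a l0) powRM ?ltW//.
have -> : ((c^-1) `^ (1 - a) = (c `^ (1 - a))^-1)%R.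
  apply: (mulfI (_ : c `^ (1 - a) != 0)%R); first by rewrite gt_eqF ?powR_gt0.
  by rewrite -powRM ?invr_ge0 ?ltW// divff ?gt_eqF// powR1 divff// gt_eqF ?powR_gt0.
rewrite invfM; set u := (_^-1)%R; set v := ((c `^ _)^-1)%R.
by rewrite mulrA -!mulrA; congr (_ * _)%R; rewrite mulrCA mulVKf ?gt_eqF.
Qed.

Lemma poweR_lower l m z a : (0 < l)%R -> 0 < z -> z <= l%:E * m -> (a <= 1)%R ->
  (l `^ a)%:E * poweR m^-1 (1 - a) * (l^-1%:E * z) <= poweR z a.
Proof.
(* The case [a = 1] is separate because [0^0 = 1]: for infinite [m] the factor [poweR m^-1 (1 - a)]
   is 1 there, but 0 when [a < 1]. *)
move=> l0 z0 zlm; rewrite le_eqVlt => /orP[/eqP ->|a1].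
  rewrite subrr poweRe0 mule1 powRr1 ?(ltW l0)// muleA -EFinM divff ?gt_eqF// mul1e.
  by rewrite poweRe1 // ltW.
move: m zlm => [m| |]; last 2 first.
- by move=> _; rewrite invey poweR0r ?mule0 ?mul0e ?poweR_ge0// subr_eq0 gt_eqF.
- by rewrite gt0_muleNy ?lte_fin// leeNy_eq => /eqP z_; rewrite z_ in z0.
move: z z0 => [z| |]//=; rewrite !lte_fin -EFinM lee_fin => z0 zlm.
have m0 : (0 < m)%R by rewrite -(pmulr_rgt0 _ l0) (lt_le_trans z0).
rewrite inver gt_eqF// poweR_EFin -!EFinM lee_fin powR_const// (powR_1B _ a z0).
rewrite ler_pM2r// lef_pV2 ?posrE ?powR_gt0 ?mulr_gt0//.
by apply: ge0_ler_powR => //; rewrite ?nnegrE ltW ?mulr_gt0 ?subr_gt0.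
Qed.

Lemma poweR_upper l c z a : (0 < l)%R -> (0 < c)%R -> (l * c)%:E < z -> (a <= 1)%R ->
  poweR z a <= (l `^ a * (c^-1) `^ (1 - a))%:E * (l^-1%:E * z).
Proof.
move=> l0 c0; move: z => [z| |]//; rewrite ?lte_fin => lcz a1; last first.
  rewrite !gt0_muley ?lte_fin ?invr_gt0 ?mulr_gt0 ?powR_gt0 ?invr_gt0//.
  exact: leey.
have z0 : (0 < z)%R by rewrite (lt_trans _ lcz)// mulr_gt0.
rewrite poweR_EFin -!EFinM lee_fin powR_const// (powR_1B _ a z0).
rewrite ler_pM2r// lef_pV2 ?posrE ?powR_gt0 ?mulr_gt0//.
by apply: ge0_ler_powR; rewrite ?nnegrE ?subr_ge0 // ltW ?mulr_gt0.
Qed.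

(** Lets [c] increase to [m]. In terms of [y = 1 / c], which decreases to the finite and possibly
    zero number [1 / m], this is right continuity of a power. *)
Lemma poweR_limit l m x L a : (0 < l)%R -> 0 < m -> (a <= 1)%R ->
  0 <= L -> L < +oo ->
  (forall c, (0 < c)%R -> c%:E < m ->
    x <= (l `^ a * (c^-1) `^ (1 - a))%:E * L) ->
  x <= (l `^ a)%:E * poweR m^-1 (1 - a) * L.
Proof.
move=> l0 m0 a1 L0 Loo H.
have [w w0 [mw wm]] : exists2 w : R, (0 <= w)%R & m^-1 = w%:E /\
    forall y, (w < y)%R -> (y^-1)%:E < m.
  move: m m0 {H} => [m| |]// m0; last by exists 0%R => //; rewrite invey; split => // y _; rewrite ltry.
  rewrite lte_fin in m0.
  exists m^-1%R; first by rewrite invr_ge0 ltW.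
  split=> [|y my]; first by rewrite inver gt_eqF.
  have y0 : (0 < y)%R by rewrite (lt_trans _ my) ?invr_gt0.
  by rewrite lte_fin -[ltRHS]invrK ltf_pV2 ?posrE ?invr_gt0.
have {}H y : (w < y)%R -> x <= (l `^ a * y `^ (1 - a))%:E * L.
  move=> wy; have y0 : (0 < y)%R by exact: le_lt_trans wy.
  by have := H y^-1%R; rewrite invrK invr_gt0; apply => //; exact: wm.
have w1 : (w < w + 1)%R by rewrite ltrDl.
rewrite mw poweR_EFin -EFinM; move: a1; rewrite le_eqVlt => /orP[/eqP a1|a1].
  by have := H _ w1; rewrite a1 subrr !powRr0.
have b0 : (0 < 1 - a)%R by rewrite subr_gt0.
move: L L0 Loo H => [L| |]// L0 _ H; rewrite lee_fin in L0.
move: L0; rewrite le_eqVlt => /orP[/eqP L0|L0].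
  by have := H _ w1; rewrite -L0 !mule0.
rewrite leNgt; apply/negP => xlt.
have : x \is a fin_num.
  rewrite fin_numE; apply/andP; split.
    by rewrite -ltNye; apply: lt_trans xlt; rewrite -EFinM ltNyr.
  by rewrite -ltey; apply: le_lt_trans (H _ w1) _; rewrite -EFinM ltry.
move=> /fineK xE; move: xlt H; rewrite -{}xE; move: (fine x) => {}x xlt H.
set k := (l `^ a * L)%R; have k0 : (0 < k)%R by rewrite mulr_gt0 ?powR_gt0.
have {}xlt : (w `^ (1 - a) < x / k)%R.
  by rewrite ltr_pdivlMr// /k mulrCA mulrA -lte_fin EFinM.
have {}H y : (w < y)%R -> (x / k <= y `^ (1 - a))%R.
  move=> /H; rewrite -EFinM lee_fin => xy.
  by rewrite ler_pdivrMr// /k mulrCA mulrA.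
(* The power [y^b] equals [x / k], so the midpoint of [w] and [y] violates the bound [H]. *)
set b := (1 - a)%R in b0 xlt H; set y := ((x / k) `^ b^-1)%R.
have xk0 : (0 <= x / k)%R by rewrite (le_trans _ (ltW xlt)) ?powR_ge0.
have wy : (w < y)%R.
  have -> : w = ((w `^ b) `^ b^-1)%R by rewrite -powRrM divff ?gt_eqF// powRr1.
  by apply: gt0_ltr_powR; rewrite ?nnegrE ?powR_ge0 ?invr_gt0.
have := H _ (midf_lt wy).1; rewrite leNgt => /negP; apply.
have -> : (x / k = y `^ b)%R by rewrite -powRrM mulVf ?gt_eqF// powRr1.
apply: gt0_ltr_powR => //; rewrite ?nnegrE; last exact: (midf_lt wy).2.
  by rewrite (le_trans w0)// ltW// (midf_lt wy).1.
by rewrite (le_trans w0)// ltW.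
Qed.

End power_inequalities.

(** The bound that makes [Z^a] integrable with respect to a finite measure when [Z] is. *)
Lemma poweR_le1D {R : realType} (z : \bar R) (a : R) :
  0 <= z -> (0 <= a <= 1)%R -> poweR z a <= 1 + z.
Proof.
move=> z0 /andP[a0 a1]; move: z z0 => [z| |]// z0; last by rewrite addey ?leey.
rewrite poweR_EFin -EFinD lee_fin; rewrite lee_fin in z0.
have [z1|z1] := leP z 1%R.
  apply: (@le_trans _ _ 1%R); last by rewrite lerDl.
  have <- : (1 `^ a = 1)%R by rewrite powR1.
  by apply: ge0_ler_powR; rewrite ?nnegrE.
apply: (@le_trans _ _ z); last by rewrite lerDr.
by rewrite -[leRHS]powRr1//; apply: ler_powR => //; exact: ltW.
Qed.

(** * The finite measure with density [Z^a] *)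

Section power_measure.
#[local] Set Implicit Arguments.
#[local] Unset Strict Implicit.
Context d (T : measurableType d) (R : realType).
Variables (mu : {finite_measure set T -> \bar R}) (Z : T -> \bar R) (a : R).
Hypothesis mZ : measurable_fun [set: T] Z.
Hypothesis Z_ge0 : forall x, 0 <= Z x.
Hypothesis Z_int : \int[mu]_x Z x < +oo.
Hypothesis a01 : (0 <= a <= 1)%R.

Let p (B : set T) : \bar R := \int[mu]_(x in B) poweR (Z x) a.

Lemma measurable_poweRZ : measurable_fun [set: T] (fun x => poweR (Z x) a).
Proof. exact: (measurableT_comp (measurable_poweR a) mZ). Qed.

Let p0 : p set0 = 0. Proof. exact: integral_set0. Qed.

Let p_ge0 B : 0 <= p B.
Proof. by apply: integral_ge0 => x _; exact: poweR_ge0. Qed.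

Let p_sigma_additive : semi_sigma_additive p.
Proof.
exact: (@semi_sigma_additive_nng_induced _ _ _ mu (fun x => poweR (Z x) a)
  measurable_poweRZ (fun x => poweR_ge0 _ _)).
Qed.

HB.instance Definition _ := isMeasure.Build d T R p p0 p_ge0 p_sigma_additive.

Let p_fin : fin_num_fun p.
Proof.
move=> B mB; rewrite ge0_fin_numE//.
apply: (@le_lt_trans _ _ (\int[mu]_(x in B) (1 + Z x))).
  apply: ge0_le_integral => //.
  - by move=> x _; exact: poweR_ge0.
  - exact: measurable_funTS measurable_poweRZ.
  - by apply: emeasurable_funD => //; exact: measurable_funTS.
  - by move=> x _; exact: poweR_le1D.
rewrite ge0_integralD//; last exact: measurable_funTS.
rewrite integral_cst// mul1e lte_add_pinfty//.
  by rewrite ltey_eq fin_num_measure.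
apply: le_lt_trans Z_int; apply: ge0_subset_integral => //.
Qed.

HB.instance Definition _ := Measure_isFinite.Build d T R p p_fin.

Definition power_measure : {finite_measure set T -> \bar R} := p.

End power_measure.

(** * Lower and upper bounds for the cost of covers *)

Section bounds.
#[local] Set Implicit Arguments.
#[local] Unset Strict Implicit.
Context (X : pointedType) (R : realType) (S : X -> X) (A : set (set X)).
Hypothesis S_bij : bijective S.
Local Notation X0 := (sigma0 S A).
Local Notation XB := (sigmaB S A).
Variables (I : countType) (P : I -> probability XB R) (G : I -> set X0).
Hypothesis P_inv : forall i, measure_invariant (S : XB -> XB) (P i).
Hypothesis mG : forall i, measurable (G i).
Hypothesis G_disj : forall i j, i <> j -> G i `&` G j = set0.

(** For finitely many [i], each [P i Q] is at most the cost of the cover under [P i]. After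
    interchanging the sums, disjointness of the [G i] lets the bounds at each [n] add up inside one
    set. Both (i) and the lower bound in (ii) rest on this. *)
Lemma esum_le_cover_sum (nu : {measure set X0 -> \bar R}) (k : I -> \bar R)
    (Q : set XB) E :
  (forall i, 0 <= k i) -> (forall i, k i \is a fin_num) ->
  (forall i (B : set X0), measurable B -> k i * P i B <= nu (B `&` G i)) ->
  measurable Q -> covers S A Q E ->
  \esum_(i in [set: I]) (k i * P i Q) <= cover_sum S nu E.
Proof.
move=> k0 kfin kP mQ [nE QE]; apply: ge_ereal_sup => _ [F [finF _] <-].
have mE n : measurable (iter n S @^-1` E n : set X0) by exact/sigma_negP.
apply: (@le_trans _ _ (\sum_(i \in F) \sum_(0 <= n <oo) k i * P i (iter n S @^-1` E n))).
  apply: lee_fsum => // i _; rewrite -(fineK (kfin i)) nneseriesZl// fineK//.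
  apply: lee_wpmul2l => //.
  have := cover_inf_invariant_ge S_bij (P_inv i) mQ.
  by move=> /le_trans; apply; exact: cover_inf_le.
rewrite fsbig_finite//= -nneseries_sum; last by move=> i n _; rewrite mule_ge0.
apply: lee_nneseries => [n _ _|n _].
  by apply: sume_ge0 => i _; rewrite mule_ge0.
rewrite -fsbig_finite//.
apply: (@le_trans _ _ (\sum_(i \in F) nu ((iter n S @^-1` E n) `&` G i))).
  by apply: lee_fsum => // i _; exact: kP.
rewrite -measure_fin_bigcup//; last 2 first.
- apply/trivIsetP => i j _ _ /eqP ij.
  by rewrite setIACA G_disj// setI0.
- by move=> i _; exact: measurableI.
apply: le_measure; rewrite ?inE//; last by move=> x [i _ []].
apply: fin_bigcup_measurable => // i _; exact: measurableI.
Qed.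

Variables (phi0 Lam : {finite_measure set X0 -> \bar R}) (Z : X0 -> \bar R).
Hypothesis Z_ge0 : forall x, 0 <= Z x.
Hypothesis Z_RN : is_RN_derivative phi0 Lam Z.
Variables (l : I -> R) (M : I -> \bar R).
Hypothesis l_gt0 : forall i, (0 < l i)%R.
Hypothesis M_gt0 : forall i, 0 < M i.
Hypothesis P_full : forall i, P i (~` G i) = 0.
Hypothesis Lam_G : forall i (E : set X0),
  measurable E -> E `<=` G i -> Lam E = (l i)%:E * P i E.
Hypothesis G_gt0 : forall i x, G i x -> 0 < Z x.
Hypothesis G_le : forall i x, G i x -> Z x <= (l i)%:E * M i.
Variable a : R.
Hypothesis a01 : (0 <= a <= 1)%R.

Let mZ : measurable_fun [set: X0] Z := Z_RN.1.

Definition weight i : \bar R := (l i `^ a)%:E * poweR (M i)^-1 (1 - a).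

Lemma weight_ge0 i : 0 <= weight i.
Proof. by rewrite mule_ge0 ?poweR_ge0// lee_fin powR_ge0. Qed.

Lemma weight_fin i : weight i \is a fin_num.
Proof.
rewrite fin_numM// fin_num_poweR// fin_numV// ?gt_eqF//.
exact: lt_trans (ltNyr 0) (M_gt0 i).
Qed.

Let mZa : measurable_fun [set: X0] (fun x => poweR (Z x) a).
Proof. exact: measurable_poweRZ. Qed.

Let P_integral i (E : set X0) : measurable E -> E `<=` G i ->
  P i E = \int[phi0]_(x in E) ((l i)^-1%:E * Z x).
Proof.
move=> mE EG; rewrite ge0_integralZl//; last 2 first.
- exact: measurable_funTS.
- by rewrite lee_fin invr_ge0 ltW.
rewrite -Z_RN.2// (Lam_G mE EG) muleA -EFinM mulVf ?mul1e//.
by rewrite gt_eqF.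
Qed.

Let P_outside i (E : set XB) : measurable E -> E `<=` ~` G i -> P i E = 0.
Proof.
move=> mE EG; apply: (@subset_measure0 _ _ _ (P i) _ (~` G i)) => //.
  exact: measurable0B (measurableC (mG i)).
exact: P_full.
Qed.

Let P_GI i (B : set X0) : measurable B -> P i B = P i (B `&` G i).
Proof.
move=> mB; have mBB := measurable0B mB; have mGB := measurable0B (mG i).
have mD : measurable (B `\` G i : set XB) by exact: measurableD.
have D0 : P i (B `\` G i) = 0.
  by apply: P_outside => // x [].
by rewrite [LHS](measureDI (P i) mBB mGB) [X in X + _]D0 add0e.
Qed.

Lemma weight_le i (B : set X0) : measurable B ->
  weight i * P i B <= \int[phi0]_(x in B `&` G i) poweR (Z x) a.
Proof.
move=> mB; have mI : measurable (B `&` G i) by exact: measurableI.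
rewrite P_GI// (P_integral mI (@subIsetr _ B (G i))).
have mlZ : measurable_fun (B `&` G i) (fun x => (l i)^-1%:E * Z x).
  by apply: measurable_funeM; exact: measurable_funTS.
have lZ0 x : 0 <= (l i)^-1%:E * Z x.
  by rewrite mule_ge0// lee_fin invr_ge0 ltW.
rewrite -ge0_integralZl//; last exact: weight_ge0.
apply: ge0_le_integral => //.
- by move=> x _; rewrite mule_ge0// weight_ge0.
- exact: measurable_funeM.
- exact: measurable_funTS mZa.
move=> x [_ Gx]; apply: poweR_lower => //; [exact: G_gt0 Gx|exact: G_le|].
by case/andP: a01.
Qed.

Lemma power_le i c (E : set X0) : (0 < c)%R -> measurable E ->
  E `<=` G i `&` [set x | (l i * c)%:E < Z x] ->
  \int[phi0]_(x in E) poweR (Z x) a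
    <= (l i `^ a * (c^-1) `^ (1 - a))%:E * P i E.
Proof.
move=> c0 mE EG; have EGi : E `<=` G i by move=> x /EG[].
have mlZ : measurable_fun E (fun x => (l i)^-1%:E * Z x).
  by apply: measurable_funeM; exact: measurable_funTS.
have lZ0 x : 0 <= (l i)^-1%:E * Z x.
  by rewrite mule_ge0// lee_fin invr_ge0 ltW.
have k0 : 0 <= (l i `^ a * (c^-1) `^ (1 - a))%:E.
  by rewrite lee_fin mulr_ge0 ?powR_ge0.
rewrite (P_integral mE EGi) -ge0_integralZl//.
apply: ge0_le_integral => //.
- by move=> x _; exact: poweR_ge0.
- exact: measurable_funTS mZa.
- exact: measurable_funeM.
by move=> x /EG[_ /= lcZ]; apply: poweR_upper => //; case/andP: a01.
Qed.

Variables (LamB : {measure set XB -> \bar R}).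
Hypothesis LamB_inv : measure_invariant (S : XB -> XB) LamB.
Hypothesis LamB_ext : forall E : set X0, measurable E -> LamB E = Lam E.
Hypothesis LamB_null : forall N : set XB, measurable N ->
  (forall i, P i N = 0) -> LamB N = 0.
Hypothesis P_ergodic : forall i, measure_ergodic (S : XB -> XB) (P i).
Hypothesis P_lub : forall i (c : R), c%:E < M i ->
  0 < P i (G i `&` [set x | (l i * c)%:E < Z x]).
Hypothesis ac : forall E : set X0, measurable E -> Lam E = 0 ->
  \int[phi0]_(x in E) poweR (Z x) a = 0.

Let LamB_fin : LamB [set: X] < +oo.
Proof.
by rewrite LamB_ext ?ltey_eq ?fin_num_measure.
Qed.

Let Z_int : \int[phi0]_x Z x < +oo.
Proof. by rewrite -Z_RN.2// ltey_eq fin_num_measure. Qed.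

Let nu : {finite_measure set X0 -> \bar R} := power_measure mZ Z_ge0 Z_int a01.

Let cover_inf_LamB_null (N : set XB) : measurable N ->
  (forall i, P i N = 0) -> cover_inf S A nu N = 0.
Proof.
move=> mN PN; apply: (cover_inf_null S_bij LamB_inv LamB_fin) => //.
  by move=> E mE LE; apply: ac => //; rewrite -LamB_ext.
exact: LamB_null.
Qed.

Lemma cover_inf_component i (Q : set XB) : measurable Q ->
  cover_inf S A nu (Q `&` G i) <= weight i * P i Q.
Proof.
move=> mQ; have mGB k := measurable0B (mG k).
apply: poweR_limit => //.
- by case/andP: a01.
- exact: le_lt_trans (probability_le1 _ mQ) (ltry _).
move=> c c0 cM; set D := G i `&` [set x | (l i * c)%:E < Z x].
have mD : measurable (D : set X0).
  by apply: measurableI => //; rewrite -[X in measurable X]setTI; exact: emeasurable_fun_o_infty.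
have mV := measurable_visits S_bij mD.
have Pfin : P i [set: X] < +oo by rewrite probability_setT ltry.
have V0 := visits_full S_bij (P_inv i) Pfin mD (P_ergodic i) (P_lub cM).
(* [N] is null for every component: for [i] by recurrence to [D], for the others because they do not
   charge [G i]. *)
pose N : set XB := (G i : set XB) `&` ~` visits S D.
have mN : measurable N by apply: measurableI => //; exact: measurableC.
have N0 : cover_inf S A nu N = 0.
  apply: cover_inf_LamB_null => // j; have [<-|/eqP ij] := eqVneq i j.
    apply: (@subset_measure0 _ _ _ (P i) _ (~` visits S D)) => //.
      exact: measurableC.
    by move=> x [].
  by apply: P_outside => // x [Gi _] Gj; have /seteqP[/(_ x (conj Gi Gj))] := G_disj ij.
apply: (@le_trans _ _ (cover_inf S A nu ((Q `&` visits S D) `|` N))).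
  apply: cover_inf_subset => x [Qx Gx].
  by have [Vx|Vx] := pselect (visits S D x); [left|right].
apply: le_trans (cover_infU S_bij nu _ _) _.
rewrite N0 adde0.
apply: (cover_inf_visits S_bij (P_inv i) Pfin mD (nu := nu)) => //.
  by rewrite mulr_gt0 ?powR_gt0 ?invr_gt0.
by move=> E mE ED; exact: power_le.
Qed.

Lemma cover_inf_le_esum (Q : set XB) : measurable Q ->
  cover_inf S A nu Q <= \esum_(i in [set: I]) (weight i * P i Q).
Proof.
move=> mQ; have mGB k := measurable0B (mG k).
(* [pickle_inv] returns [Some i] only at the code of [i], so each index is counted exactly once in
   the series. *)
pose B (n : nat) : set XB := if @pickle_inv I n is Some i then Q `&` G i else set0.
pose b (n : nat) := if @pickle_inv I n is Some i then weight i * P i Q else 0.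
have b0 n : 0 <= b n.
  by rewrite /b; case: pickle_inv => // i; rewrite mule_ge0// weight_ge0.
have mB n : measurable (B n).
  by rewrite /B; case: pickle_inv => // i; exact: measurableI.
have -> : \esum_(i in [set: I]) (weight i * P i Q) = \sum_(0 <= n <oo) b n.
  rewrite nneseries_esumT//.
  have -> : \esum_(n in [set: nat]) b n = \esum_(n in pickle @` [set: I]) b n.
    rewrite [RHS]esum_mkcond; apply: eq_esum => n _.
    case: ifPn => // /negP nI; rewrite /b.
    case e: (@pickle_inv I n) => [i|//]; exfalso; apply: nI; rewrite inE.
    exists i => //; have := @pickle_invK I n; rewrite /ocancel e /=; exact.
  rewrite esum_image; last by move=> i j _ _; exact: (pcan_inj pickleK_inv).
  by apply: eq_esum => i _; rewrite /b pickleK_inv.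
pose N := Q `\` \bigcup_n B n.
have mU : measurable (\bigcup_n B n) by exact: bigcup_measurable.
have mN : measurable N by exact: measurableD.
have N0 : cover_inf S A nu N = 0.
  apply: cover_inf_LamB_null => // i.
  by apply: P_outside => // x [Qx Bx] Gx; apply: Bx; exists (pickle i) => //; rewrite /B pickleK_inv.
apply: (@le_trans _ _ (cover_inf S A nu ((\bigcup_n B n) `|` N))).
  apply: cover_inf_subset => x Qx.
  by have [Ux|Ux] := pselect ((\bigcup_n B n) x); [left|right].
apply: le_trans (cover_infU S_bij nu _ _) _.
rewrite N0 adde0.
apply: le_trans (cover_inf_sigma_subadditive S_bij nu B) _.
apply: lee_nneseries => [n _ _|n _]; first exact: cover_inf_ge0.
rewrite /B /b; case: pickle_inv => [i|]; first exact: cover_inf_component.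
by rewrite cover_inf0.
Qed.

Lemma cover_inf_power (Q : set XB) : measurable Q ->
  cover_inf S A (fun B => \int[phi0]_(x in (B : set X0)) poweR (Z x) a) Q =
  \esum_(i in [set: I]) (weight i * P i Q).
Proof.
move=> mQ; apply/eqP; rewrite eq_le (cover_inf_le_esum mQ) andTb.
apply: le_ereal_inf_tmp => _ [E QE <-].
apply: (@esum_le_cover_sum nu) => //; [exact: weight_ge0|exact: weight_fin|exact: weight_le].
Qed.

End bounds.

(** * Essential suprema of densities *)

Section essential_supremum.
#[local] Set Implicit Arguments.
#[local] Unset Strict Implicit.
Context (X : pointedType) (R : realType) (S : X -> X) (A : set (set X)).
Local Notation X0 := (sigma0 S A).
Local Notation XB := (sigmaB S A).
Variables (P : probability XB R) (g : X0 -> \bar R).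
Hypothesis mg : measurable_fun [set: X0] g.

Let mlt (c : \bar R) : measurable ([set x | c < g x] : set XB).
Proof.
by apply: measurable0B; rewrite -[X in measurable X]setTI;
  exact: emeasurable_fun_o_infty.
Qed.

Lemma ess_sup_ub : P [set x | ess_sup P (g : XB -> \bar R) < g x] = 0.
Proof.
have [B [mB B0 NB]] := ess_sup_ge P (g : XB -> \bar R).
apply: (@subset_measure0 _ _ _ P _ B) => // x /= gx.
by apply: NB => /=; apply/negP; rewrite -ltNge.
Qed.

Lemma ess_sup_lub (c : \bar R) : c < ess_sup P (g : XB -> \bar R) ->
  P [set x | c < g x] <> 0.
Proof.
rewrite ltNge => /negP cM P0; apply: cM; apply/ess_supP.
by exists [set x | c < g x]; split => // x /= /negP; rewrite -ltNge.
Qed.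

(** A density that is at most zero almost everywhere would give total mass zero. Positivity makes
    the inverse of the essential supremum finite. *)
Lemma ess_sup_density_gt0 (mu : {measure set X0 -> \bar R}) :
  is_RN_derivative mu P g -> 0 < ess_sup P (g : XB -> \bar R).
Proof.
move=> gE; rewrite ltNge; apply/negP => M0.
have P0 : P [set x | 0 < g x] = 0.
  apply: (@subset_measure0 _ _ _ P _ _ _ _ _ ess_sup_ub) => // x /= gx.
  exact: le_lt_trans gx.
have mC : measurable ([set x | g x <= 0] : set X0).
  by rewrite -[X in measurable X]setTI; exact: emeasurable_fun_infty_c.
have C0 : P [set x | g x <= 0] = 0.
  apply/eqP; rewrite eq_le measure_ge0 andbT gE.2//.
  under eq_integral do rewrite -[g _]oppeK.
  rewrite integral_ge0N => [|x]; last by rewrite oppe_ge0.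
  by rewrite oppe_le0; apply: integral_ge0 => x; rewrite oppe_ge0.
have UT : [set x | 0 < g x] `|` [set x | g x <= 0] = [set: X].
  by apply/seteqP; split => // x _ /=; case: (ltP 0 (g x)); [left|right].
have PT : P [set: X] = 0.
  by rewrite -UT; exact: null_set_setU (mlt 0) (measurable0B mC) P0 C0.
by move: PT; rewrite probability_setT => /eqP; rewrite onee_eq0.
Qed.

End essential_supremum.

(** [Z] vanishes [mu]-almost everywhere on [E], hence so does its power; [0 < a] enters through
    [0^a = 0]. *)
Lemma poweR_integral_null d (T : measurableType d) (R : realType)
    (mu : {measure set T -> \bar R}) (Z : T -> \bar R) (a : R) (E : set T) :
  measurable_fun [set: T] Z -> (forall x, 0 <= Z x) -> (0 < a)%R ->
  measurable E -> \int[mu]_(x in E) Z x = 0 ->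
  \int[mu]_(x in E) poweR (Z x) a = 0.
Proof.
move=> mZ Z0 a0 mE ZE.
have ae : ae_eq mu E Z (cst 0).
  apply/(ae_eq_integral_abs mu mE (measurable_funTS mZ)).
  by under eq_integral do rewrite gee0_abs//.
rewrite -(integral0 mu E); apply: ge0_ae_eq_integral => //.
- exact: measurable_funTS (measurable_poweRZ a mZ).
- by move=> x _; exact: poweR_ge0.
by apply: filterS ae => x H Ex; rewrite H// poweR0r// gt_eqF.
Qed.

Theorem theorem10 (R : realType) (X : pointedType) (S : X -> X)
  (A : set (set X))
  (S_bij : bijective S) (A_sigma : sigma_algebra [set: X] A)
  (phi0 Lam : {finite_measure set (sigma0 S A) -> \bar R})
  (Lam_inv : measure_invariant (S : sigma0 S A -> sigma0 S A) Lam)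
  (Lam_ac : Lam `<< phi0)
  (Z : sigma0 S A -> \bar R)
  (Z_ge0 : forall x, 0 <= Z x) (Z_RN : is_RN_derivative phi0 Lam Z)
  (* the S-invariant extension of Lam to the larger sigma-algebra *)
  (LamB : {measure set (sigmaB S A) -> \bar R})
  (LamB_inv : measure_invariant (S : sigmaB S A -> sigmaB S A) LamB)
  (LamB_ext : forall E : set (sigma0 S A), measurable E -> LamB E = Lam E)
  (Lam_1 : Lam [set: X] = 1)
  (I : countType) (lam : I -> R)
  (Lami : I -> probability (sigmaB S A) R)
  (Lami_distinct : forall i j : I, i <> j ->
    exists2 E : set (sigmaB S A), measurable E & Lami i E <> Lami j E)
  (Lami_ergodic : forall i, measure_ergodic (S : sigmaB S A -> sigmaB S A) (Lami i))
  (lam_01 : forall i, (0 < lam i <= 1)%R)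
  (Lam_decomp : forall E : set (sigmaB S A), measurable E ->
    LamB E = \esum_(i in [set: I]) ((lam i)%:E * Lami i E))
  (Zi : I -> sigma0 S A -> \bar R)
  (Zi_RN : forall i, is_RN_derivative phi0 (Lami i) (Zi i))
  (M : I -> \bar R)
  (M_def : forall i, M i = ess_sup (Lami i) (Zi i : sigmaB S A -> \bar R))
  (Q : set (sigmaB S A)) (Q_meas : measurable Q) :
  let formula_ii (alpha : R) :=
    Halpha phi0 Z alpha Q =
      \esum_(i in [set: I])
        ((lam i `^ alpha)%:E * poweR ((M i)^-1) (1 - alpha)%R * Lami i Q) in
  [/\ \esum_(i in [set: I]) ((M i)^-1 * Lami i Q) + Phi0_bar phi0 Z Q
        <= Phi phi0 Q,
      forall alpha : R, (0 < alpha <= 1)%R -> formula_ii alpha &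
      phi0 `<< Lam -> formula_ii 0%R].
Proof.
move=> formula_ii.
(* The given derivatives may take negative values; truncation at 0 keeps them derivatives and
   preserves the essential suprema. *)
pose f i (x : sigma0 S A) := maxe (Zi i x) 0.
have f_ge0 i x : 0 <= f i x by rewrite le_max lexx orbT.
have [f_RN Zi_neg] : (forall i, is_RN_derivative phi0 (Lami i) (f i)) /\
    forall i, Lami i [set x | Zi i x < 0] = 0.
  by split => i;
    have [] := @is_RN_derivative_max0 _ _ _ phi0 (restrict0 (Lami i)) _ (Zi_RN i).
have mf i : measurable_fun [set: sigma0 S A] (f i) := (f_RN i).1.
have {}M_def i : M i = ess_sup (Lami i) (f i : sigmaB S A -> \bar R).
  rewrite M_def; apply: eq_ess_sup; exists [set x | Zi i x < 0]; split; [|exact: Zi_neg|].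
    apply: measurable0B; rewrite -[X in measurable X]setTI.
    by apply: emeasurable_fun_infty_o => //; exact: (Zi_RN i).1.
  move=> x /= H; rewrite ltNge; apply/negP => Zx; apply: H.
  by apply/esym/max_idPl.
have M_gt0 i : 0 < M i by rewrite M_def; exact: ess_sup_density_gt0 (f_RN i).
have M_ub i : Lami i [set x | M i < f i x] = 0 by rewrite M_def; exact: ess_sup_ub.
have M_lub i (c : R) : c%:E < M i -> Lami i [set x | c%:E < f i x] <> 0.
  by rewrite M_def; exact: ess_sup_lub.
have l_gt0 i : (0 < lam i)%R by case/andP: (lam_01 i).
pose G := component Z lam f M.
have mG i : measurable (G i) by exact: (measurable_component Z_RN lam M f_RN i).
have G_disj i j : i <> j -> G i `&` G j = set0 by exact: component_disjoint.
have G_full i : Lami i (~` G i) = 0.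
  exact: (component_full S_bij Z_ge0 Z_RN LamB_ext).
have Lam_G i (E : set (sigma0 S A)) : measurable E -> E `<=` G i ->
    Lam E = (lam i)%:E * Lami i E.
  exact: (Lam_component S_bij Z_RN LamB_ext).
have G_gt0 i x : G i x -> 0 < Z x by exact: component_gt0.
have G_le i x : G i x -> Z x <= (lam i)%:E * M i by exact: component_le.
have G_lub i (c : R) : c%:E < M i ->
    0 < Lami i (G i `&` [set x | (lam i * c)%:E < Z x]).
  exact: (component_lub S_bij Z_ge0 Z_RN LamB_ext).
have Lami_inv i := (Lami_ergodic i).1.
have formula a : (0 <= a <= 1)%R ->
    (forall E : set (sigma0 S A), measurable E -> Lam E = 0 ->
      \int[phi0]_(x in E) poweR (Z x) a = 0) -> formula_ii a.
  move=> a01 ac; rewrite /formula_ii.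
  exact: (cover_inf_power S_bij Lami_inv mG G_disj Z_ge0 Z_RN l_gt0 M_gt0 G_full
    Lam_G G_gt0 G_le a01 LamB_inv LamB_ext (LamB_null Lam_decomp) Lami_ergodic
    G_lub ac Q_meas).
split; last 2 first.
- move=> a /andP[a0 a1]; apply: formula; first by rewrite ltW.
  move=> E mE LE; apply: poweR_integral_null => //; first exact: Z_RN.1.
  by rewrite -Z_RN.2.
(* Since [0^0 = 1], the function [Z^0] is constantly 1, and the required condition is that
   [Lam]-null sets be [phi0]-null. *)
- move=> /null_content_dominatesP dom; apply: formula; first by rewrite lexx ler01.
  move=> E mE LE; apply: null_set_integral => //; last exact: dom.
  exact: measurable_funTS (measurable_poweRZ 0 Z_RN.1).
set a := \esum_(i in _) _.
have mZ0 : measurable [set x | Z x = 0].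
  by rewrite -[X in measurable X]setTI; apply: measurable_eqe => //; exact: Z_RN.1.
pose z := cover_sum S (fun B => phi0 ([set x | Z x = 0] `&` B)).
(* [phi0] is split along [{Z = 0}]. The sets [G i] lie in [{Z > 0}], so the part there obeys the
   lower bound with the weights of exponent 0, which are [1 / M i]. *)
have split_sum E : covers S A Q E -> a + z E <= cover_sum S phi0 E.
  move=> QE; have mE n : measurable (iter n S @^-1` E n : set (sigma0 S A)).
    by apply/sigma_negP => //; exact: QE.1.
  have mZC := measurableC mZ0.
  pose nu := mrestr phi0 mZC.
  have -> : cover_sum S phi0 E = cover_sum S nu E + z E.
    rewrite /cover_sum -nneseriesD//; apply: eq_eseriesr => n _.
    by rewrite (measureDI phi0 (mE n) mZ0) setIC setDE.
  apply: leeD2r; apply: (esum_le_cover_sum S_bij Lami_inv mG G_disj (nu := nu)) => //.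
  - by move=> i; rewrite inve_ge0 ltW.
  - move=> i; rewrite fin_numV// ?gt_eqF//; exact: lt_trans (ltNyr 0) (M_gt0 i).
  move=> i B mB; have mBG : measurable (B `&` G i) by exact: measurableI.
  have zero01 : (0 <= (0 : R) <= 1)%R by rewrite lexx ler01.
  have := weight_le mG Z_ge0 Z_RN l_gt0 G_full Lam_G G_gt0 G_le zero01 i mB.
  rewrite /weight powRr0 mul1e subr0 poweRe1 ?inve_ge0 ?(ltW (M_gt0 i))// => /le_trans; apply.
  under eq_integral do rewrite poweRe0.
  rewrite integral_cst// mul1e /nu /mrestr; apply: le_measure; rewrite ?inE//.
    exact: measurableI.
  by move=> x [Bx Gx]; split => //= Zx; have := G_gt0 _ _ Gx; rewrite Zx ltxx.
have a_ge0 : 0 <= a.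
  by apply: esum_ge0 => i _; rewrite mule_ge0// inve_ge0 ltW.
have z_ge0 E : 0 <= z E by exact: nneseries_ge0.
(* Finiteness of [Phi] and then of [a] allows [a] to be subtracted in the bounds on covers. *)
have Phi_fin : Phi phi0 Q \is a fin_num.
  rewrite ge0_fin_numE; last exact: (cover_inf_ge0 phi0 Q).
  apply: (@le_lt_trans _ _ (phi0 setT)); last by rewrite ltey_eq fin_num_measure.
  apply: le_trans (cover_inf_sigma_neg S_bij phi0 (sigma_negT A S_bij 0)).
  exact: cover_inf_subset.
have a_fin : a \is a fin_num.
  rewrite ge0_fin_numE//; apply: (@le_lt_trans _ _ (Phi phi0 Q)).
    apply: le_ereal_inf_tmp => _ [E QE <-]; apply: le_trans (split_sum E QE).
    by rewrite leeDl.
  by rewrite ltey_eq Phi_fin.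
pose g eps := ereal_sup [set z E | E in covers_eps phi0 eps Q].
have g_le eps : g eps <= Phi phi0 Q + eps%:E - a.
  apply: ge_ereal_sup => _ [E [QE Eeps] <-]; rewrite leeBrDl//.
  exact: le_trans (split_sum E QE) (ltW Eeps).
(* Monotonicity in [eps] ensures that the right limit at 0 in [Phi0_bar] exists. *)
have g_mono : {homo g : x y / (x <= y)%R >-> x <= y}.
  move=> x y xy; apply: ge_ereal_sup => _ [E [QE Ex] <-].
  apply: ereal_sup_ubound; exists E => //; split => //.
  by apply: lt_le_trans Ex _; rewrite leeD2l// lee_fin.
have g_cvg : cvg (g eps @[eps --> (0 : R)^'+]).
  apply: nondecreasing_at_right_is_cvge; apply: nearW => x u v _ _.
  exact: g_mono.
(* Every [x <= e] gives [g x <= Phi + e - a], and the limit inherits this bound. *)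
apply/lee_addgt0Pr => e e0; rewrite -leeBrDl//; apply: lime_le => //.
near=> x; apply: le_trans (g_le x) _; rewrite leeB// leeD2l// lee_fin.
by near: x; exact: nbhs_right_le.
Unshelve. all: by end_near. Qed.
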